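(* Let $\mathfrak{S}_n$ denote the set of permutations $\pi=(\pi(1),\ldots,\pi(n))$ of $\{1,2,\ldots,n\}$. (i) For any integer $n>5$, there is a permutation $\pi\in \mathfrak{S}_n$ such that $$\sum_{k=1}^{n-1} \frac{1}{\pi(k)-\pi(k+1)}=0.$$ (ii) For any integer $n>7$, there is a permutation $\pi\in \mathfrak{S}_n$ such that $$\sum_{k=1}^{n-1} \frac{1}{\pi(k)-\pi(k+1)} + \frac{1}{\pi(n)-\pi(1)}=0.$$ (iii) For any integer $n>5$, there is a permutation $\pi\in \mathfrak{S}_n$ such that $$\sum_{k=1}^{n-1} \frac{1}{\pi(k)\pi(k+1)}=1.$$ *)

(* Defs.v *)
From mathcomp Require Import all_boot all_order perm all_algebra.

Set Implicit Arguments.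
Unset Strict Implicit.
Unset Printing Implicit Defensive.

Import GRing.Theory.
Local Open Scope ring_scope.

(* Elements of 'S_n permute {0, ..., n-1}; [entry p k] is the k-th entry pi(k)
   of the corresponding permutation pi of {1, ..., n}, with 1-based positions:
   pi(k) = p(k-1) + 1.  It is only meaningful for 1 <= k <= n. *)
Definition entry (n : nat) (p : 'S_n) (k : nat) : rat :=
  if insub k.-1 is Some i then (p i).+1%:R else 0.

(* Main.v *)
(** Every solution grows out of a small one by local moves that preserve the sum.

    (i) A path on {1..n} starting at n can be preceded by n+3, n+1, n+2, since
    1/2 - 1 + 1/2 = 0.

    (ii) In a cycle with adjacent entries n, n+1 this edge can be replaced by
    n, n+2, n+3, n+1, since -1/2 - 1 + 1/2 = -1; the new cycle contains the edge
    n+2, n+3.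

    (iii) Inserting a + b between adjacent a and b does not change the sum of the
    1/(xy).  In particular a solution for n = 2m with m, m+1 adjacent gives one
    for 2m + 1.  Prepending M+1, M+2, ..., 2M+2 to a path on {1..M} that starts at
    M and has sum 1 - 1/(2M) gives, by telescoping, a solution for n = 2M + 2.  If
    such a path has 2 and M-1 adjacent, inserting M+1 between them and putting
    M+2 in front gives a path of the same kind for M + 2. *)
Require Import Defs.
From mathcomp Require Import all_boot all_order perm all_algebra.
From mathcomp Require Import zify ring lra.

Set Implicit Arguments.
Unset Strict Implicit.
Unset Printing Implicit Defensive.

Import GRing.Theory Num.Theory.
Local Open Scope ring_scope.

Ltac neq0_lra := repeat (apply/andP; split); apply/eqP => ?; lra.

Fixpoint path_sum (f : nat -> nat -> rat) (s : seq nat) : rat :=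
  if s is x :: s' then (if s' is y :: _ then f x y else 0) + path_sum f s'
  else 0.

Lemma path_sum_cons2 f x y s :
  path_sum f (x :: y :: s) = f x y + path_sum f (y :: s).
Proof. by []. Qed.

(** The cut vertex [x] is kept in both pieces, so each edge is counted exactly once. This isolates
    the edge to be replaced or subdivided. *)
Lemma path_sum_cat f s x t :
  path_sum f (s ++ x :: t) = path_sum f (s ++ [:: x]) + path_sum f (x :: t).
Proof.
elim: s => [|a [|b s] IH] /=; first by rewrite !add0r.
  by rewrite !addr0.
by move: IH => /= ->; rewrite !addrA.
Qed.

Lemma path_sum_nth f s :
  path_sum f s = \sum_(1 <= k < size s) f (nth 0%N s k.-1) (nth 0%N s k).
Proof.
elim: s => [|x [|y s] IH]; first by rewrite big_geq.
  by rewrite big_geq //= addr0.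
rewrite path_sum_cons2 IH [RHS]big_nat_recl //=; congr (_ + _).
by apply: eq_big_nat => -[].
Qed.

Lemma perm_of_seq n (s : seq nat) : perm_eq s (iota 1 n) ->
  exists p : 'S_n, forall k, (k < n)%N -> entry p k.+1 = (nth 0%N s k)%:R.
Proof.
move=> ps.
have size_s : size s = n by rewrite (perm_size ps) size_iota.
have uniq_s : uniq s by rewrite (perm_uniq ps) iota_uniq.
have s_range k : (k < n)%N -> (0 < nth 0%N s k <= n)%N.
  move=> lt_kn; have := mem_nth 0%N (s := s) (n := k).
  by rewrite size_s (perm_mem ps) mem_iota add1n ltnS => /(_ lt_kn).
have lt_s (i : 'I_n) : ((nth 0%N s i).-1 < n)%N.
  by have := s_range i (ltn_ord i); lia.
have inj_s : injective (fun i : 'I_n => Ordinal (lt_s i)).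
  move=> i j /(congr1 val) /= eq_ij; apply: val_inj; apply/eqP => /=.
  rewrite -(nth_uniq 0%N _ _ uniq_s) ?size_s //; apply/eqP.
  case/andP: (s_range i (ltn_ord i)) => i_gt0 _.
  case/andP: (s_range j (ltn_ord j)) => j_gt0 _.
  by rewrite -(prednK i_gt0) -(prednK j_gt0) eq_ij.
exists (perm inj_s) => k lt_kn.
rewrite /entry /= (insubT (fun i => i < n)%N lt_kn) permE /=.
by rewrite prednK //; case/andP: (s_range k lt_kn).
Qed.

(** Transfers a list solution to ['S_n]. The entries are returned too, since the closing edge in
    (ii) needs both endpoints. *)
Lemma perm_of_path n (s : seq nat) (g : rat -> rat -> rat) : perm_eq s (iota 1 n) ->
  exists2 p : 'S_n,
    \sum_(1 <= k < n) g (entry p k) (entry p k.+1)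
      = path_sum (fun a b => g a%:R b%:R) s
  & forall k, (k < n)%N -> entry p k.+1 = (nth 0%N s k)%:R.
Proof.
move=> ps; have [p p_s] := perm_of_seq ps; exists p => //.
rewrite path_sum_nth (perm_size ps) size_iota.
apply: eq_big_nat => -[//|k] /andP[_ lt_kn].
by rewrite !p_s // ltnW.
Qed.

Notation inv_diff := (fun a b : nat => 1 / (a%:R - b%:R) : rat).
Notation inv_prod := (fun a b : nat => 1 / (a%:R * b%:R) : rat).

Lemma linear_path n : (5 < n)%N ->
  exists2 s, perm_eq (n :: s) (iota 1 n) & path_sum inv_diff (n :: s) = 0.
Proof.
have [m] := ubnP n; elim: m n => // m IH n lt_nm lt5n.
(* The inductive step raises [n] by 3, so each residue mod 3 has its own base case. *)
have [->|[->|[->|lt8n]]] : (n = 6 \/ n = 7 \/ n = 8 \/ 8 < n)%N by lia.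
- by exists [:: 3; 5; 2; 4; 1]%N => //=; lra.
- by exists [:: 5; 6; 4; 2; 3; 1]%N => //=; lra.
- by exists [:: 2; 5; 7; 4; 6; 3; 1]%N => //=; lra.
have [k def_n] : exists k, n = k.+3 by exists (n - 3)%N; lia.
subst n; have [||s ps s0] := IH k; [by lia|by lia|].
exists [:: k.+1, k.+2, k & s].
  apply/seq.permP => a; move/seq.permP/(_ a): ps.
  by rewrite -[in iota 1 k.+3]addn3 iotaD count_cat /= add1n; lia.
rewrite !path_sum_cons2 s0 -[k.+3]addn3 -[k.+2]addn2 -[k.+1]addn1 !natrD.
by field; neq0_lra.
Qed.

(** This is the cycle cut open at its edge between [n] and [n.+1]. That edge contributes 1/(n -
    (n+1)) = -1, so the remaining path must sum to 1. *)
Lemma cyclic_path n : (6 < n)%N ->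
  exists2 s, perm_eq (n.+1 :: s ++ [:: n]) (iota 1 n.+1)
    & path_sum inv_diff (n.+1 :: s ++ [:: n]) = 1.
Proof.
have [m] := ubnP n; elim: m n => // m IH n lt_nm lt6n.
have [->|[->|lt8n]] : (n = 7 \/ n = 8 \/ 8 < n)%N by lia.
- by exists [:: 2; 3; 6; 5; 4; 1]%N => //=; lra.
- by exists [:: 3; 2; 6; 5; 7; 1; 4]%N => //=; lra.
have [k def_n] : exists k, n = k.+2 by exists (n - 2)%N; lia.
subst n; have [||s ps s1] := IH k; [by lia|by lia|].
(* The old path gains the edge from k+3 to k+1 in front and the edge from k to k+2 at the end; they
   contribute 1/2 and -1/2. *)
exists (k.+1 :: s ++ [:: k]).
  apply/seq.permP => a; move/seq.permP/(_ a): ps.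
  rewrite -[in iota 1 k.+3]addn2 iotaD /= !count_cat /= ?add1n ?addSn ?addn0.
  by lia.
rewrite cat_cons path_sum_cons2 -catA cat1s -cat_cons path_sum_cat cat_cons s1.
rewrite path_sum_cons2 /= -[k.+3]addn3 -[k.+2]addn2 -[k.+1]addn1 !natrD.
by field; neq0_lra.
Qed.

(** Along the run of consecutive integers, 1/(x(x+1)) = 1/x - 1/(x+1) telescopes. *)
Lemma path_sum_inv_prod_iota_cat x m y s : (0 < x)%N -> (0 < y)%N ->
  path_sum inv_prod (iota x m.+1 ++ y :: s)
    = 1 / x%:R - 1 / (x + m)%:R + 1 / ((x + m)%:R * y%:R)
      + path_sum inv_prod (y :: s).
Proof.
move=> x_gt0 y_gt0; elim: m x x_gt0 => [|m IH] x x_gt0.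
  by rewrite addn0 subrr add0r.
have -> : iota x m.+2 ++ y :: s = [:: x, x.+1 & iota x.+2 m ++ y :: s] by [].
rewrite path_sum_cons2; have /= -> := IH x.+1 isT.
rewrite addSnnS -[m.+1]addn1 -[x.+1]addn1 !natrD.
have m_ge0 : 0 <= m%:R :> rat by rewrite ler0n.
have x_pos : 0 < x%:R :> rat by rewrite ltr0n.
have y_pos : 0 < y%:R :> rat by rewrite ltr0n.
by field; neq0_lra.
Qed.

Lemma inv_prod_end_path N : (N = 5 \/ 6 < N)%N ->
  exists A B, perm_eq (N.+1 :: A ++ [:: 2, N & B])%N (iota 1 N.+1) /\
    path_sum inv_prod (N.+1 :: A ++ [:: 2, N & B])%N = 1 - 1 / (2 * N.+1%:R).
Proof.
have [m] := ubnP N; elim: m N => // m IH N lt_Nm NP.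
(* The step raises [N] by 2: odd values start from 5, even ones from 8. *)
have [->|[->|[k def_N kP]]] :
    (N = 5 \/ N = 8 \/ exists2 k, N = k.+2 & k = 5 \/ 6 < k)%N.
  have [->|[->|NP']] : (N = 5 \/ N = 8 \/ N = 7 \/ 8 < N)%N by lia.
  - by left.
  - by right; left.
  - by right; right; exists (N - 2)%N; lia.
- by exists [:: 1]%N, [:: 3; 4]%N; split=> //=; lra.
- by exists [:: 5; 1]%N, [:: 6; 3; 7; 4]%N; split=> //=; lra.
subst N; have [||A [B [pAB sAB]]] := IH k; [by lia|by []|].
(* The neighbour 2 makes k+2 the sum of its two new neighbours. The edge in front adds
   1/((k+1)(k+3)) = 1/(2(k+1)) - 1/(2(k+3)). *)
exists (k.+1 :: A), (k :: B); split.
  apply/seq.permP => a; move/seq.permP/(_ a): pAB.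
  rewrite -[in iota 1 k.+3]addn2 iotaD /= !count_cat /= ?add1n ?addSn ?addn0.
  by lia.
have k_gt0 : (0 < k)%N by lia.
rewrite -cat_cons path_sum_cat path_sum_cons2 in sAB.
rewrite cat_cons path_sum_cons2 -cat_cons path_sum_cat !path_sum_cons2.
move: sAB; rewrite -[k.+3]addn3 -[k.+2]addn2 -[k.+1]addn1 !natrD => sAB.
set P := path_sum _ (_ ++ _) in sAB *; set Q := path_sum _ (k :: B) in sAB *.
have -> : P = 1 - 1 / (2 * (k%:R + 1)) - (1 / (2 * k%:R) + Q).
  by rewrite -sAB addrK.
have {NP kP} k_pos : 0 < k%:R :> rat by rewrite ltr0n.
by field; neq0_lra.
Qed.

Lemma inv_prod_half_path m : (2 < m)%N -> exists A B,
  perm_eq (A ++ [:: m, m.+1 & B]) (iota 1 m.*2) /\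
  path_sum inv_prod (A ++ [:: m, m.+1 & B]) = 1.
Proof.
move=> lt2m.
(* The general construction uses [inv_prod_end_path] at m - 2, which covers m = 7 and m > 8. *)
have [->|[->|[->|[->|[->|mP]]]]] : (m = 3 \/ m = 4 \/ m = 5 \/ m = 6 \/ m = 8
    \/ m.-2 = 5 \/ 6 < m.-2)%N by lia.
- by exists [:: 2; 1]%N, [:: 5; 6]%N; split=> //=; lra.
- by exists [::], [:: 6; 7; 8; 3; 1; 2]%N; split=> //=; lra.
- by exists [:: 2; 1; 4; 3]%N, [:: 7; 8; 9; 10]%N; split=> //=; lra.
- by exists [::], [:: 8; 9; 10; 11; 12; 5; 3; 4; 1; 2]%N; split=> //=; lra.
- exists [:: 3; 7; 4; 5; 1; 2; 6]%N, [:: 10; 11; 12; 13; 14; 15; 16]%N.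
  by split=> //=; lra.
have [N def_m] : exists N, m = N.+2 by exists m.-2; lia.
subst m; have [A [B [pAB sAB]]] := @inv_prod_end_path N mP.
set s := N.+1 :: _ in pAB sAB.
(* The run N+2, ..., 2N+4 and its edge to N+1 contribute 1/(2(N+1)), exactly what [s] lacks. The run
   starts with the required pair [m], [m.+1]. *)
exists [::], (iota N.+4 N.+1 ++ s).
have -> : [::] ++ [:: N.+2, N.+3 & iota N.+4 N.+1 ++ s] = iota N.+2 N.+3 ++ s.
  by [].
split.
  have -> : N.+2.*2 = (N.+1 + N.+3)%N by lia.
  by rewrite iotaD add1n perm_catC perm_cat2r.
rewrite /s path_sum_inv_prod_iota_cat // -/s sAB.
have {lt2m mP} N_ge0 : 0 <= N%:R :> rat by rewrite ler0n.
rewrite -[N.+2]addn2 -[N.+1]addn1 !natrD.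
by field; neq0_lra.
Qed.

Lemma inv_prod_path n : (5 < n)%N ->
  exists2 s, perm_eq s (iota 1 n) & path_sum inv_prod s = 1.
Proof.
move=> lt5n.
have [m def_n] : exists m, (n = m.*2 \/ n = m.*2.+1)%N by exists n./2; lia.
have lt2m : (2 < m)%N by lia.
have [A [B [pAB sAB]]] := inv_prod_half_path lt2m.
case: def_n => ->; first by exists (A ++ [:: m, m.+1 & B]).
exists (A ++ [:: m, m.*2.+1, m.+1 & B]).
  apply/seq.permP => a; move/seq.permP/(_ a): pAB.
  have := iotaD 1 m.*2 1; rewrite addn1 => ->.
  by rewrite !count_cat /= add1n; lia.
rewrite -[RHS]sAB path_sum_cat [in RHS]path_sum_cat !path_sum_cons2.
rewrite -[m.*2.+1]addn1 -[m.+1]addn1 -addnn !natrD.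
have m_pos : 0 < m%:R :> rat by rewrite ltr0n; lia.
by field; neq0_lra.
Qed.

Theorem theorem1 :
  [/\ forall n : nat, (5 < n)%N ->
        exists p : 'S_n,
          \sum_(1 <= k < n) 1 / (entry p k - entry p k.+1) = 0,
      forall n : nat, (7 < n)%N ->
        exists p : 'S_n,
          \sum_(1 <= k < n) 1 / (entry p k - entry p k.+1)
            + 1 / (entry p n - entry p 1) = 0
    & forall n : nat, (5 < n)%N ->
        exists p : 'S_n,
          \sum_(1 <= k < n) 1 / (entry p k * entry p k.+1) = 1].
Proof.
split.
- move=> n /linear_path[s ps s0].
  have [p sum_p _] := perm_of_path (fun x y => 1 / (x - y)) ps.
  by exists p; rewrite sum_p.
- case=> // n /cyclic_path[s ps s1].
  have [p sum_p p_s] := perm_of_path (fun x y => 1 / (x - y)) ps.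
  have size_s : size (n.+1 :: s ++ [:: n]) = n.+1.
    by rewrite (perm_size ps) size_iota.
  have last_s : nth 0%N (n.+1 :: s ++ [:: n]) n = n.
    rewrite -[X in nth _ _ X]/(n.+1.-1) -[in n.+1.-1]size_s nth_last /=.
    by rewrite last_cat.
  exists p; rewrite sum_p s1 !p_s // last_s /= -[n.+1]addn1 natrD.
  by field; neq0_lra.
- move=> n /inv_prod_path[s ps s1].
  have [p sum_p _] := perm_of_path (fun x y => 1 / (x * y)) ps.
  by exists p; rewrite sum_p.
Qed.
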